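(* Let $U\subseteq R_{a,b}$ be a basepoint free four-dimensional subspace with basis $\{p_0,p_1,p_2,p_3\}$, where $b\geq 3$, and let $I_U=(p_0,p_1,p_2,p_3)\subseteq R$. Assume that $I_U$ has a first syzygy $Q$ of bidegree $(0,2)$ and no linear first syzygy, and let $V\subseteq U$ be the subspace associated to $Q$. If $\dim_k V=3$, then $I_U$ has a syzygy $S_1$ of bidegree $(a,b-2)$ and two syzygies $S_2,S_3$ of bidegree $(a,b-1)$ such that $\dim_k\langle Q,S_1,S_2,S_3\rangle_{2a-1,b-1}=2ab$.
   Context: Let $k$ be an algebraically closed field and $R=k[s,t,u,v]$, bigraded by $\mathrm{bideg}\, s=\mathrm{bideg}\, t=(1,0)$ and $\mathrm{bideg}\, u=\mathrm{bideg}\, v=(0,1)$; $R_{c,d}$ is the bidegree $(c,d)$ component. Here $a\ge 1$. $U$ is basepoint free if $p_0,\dots,p_3$ have no common zero on $\mathbb{P}^1\times\mathbb{P}^1$, equivalently $\sqrt{I_U}=(s,t)\cap(u,v)$. Syzygies: $\mathrm{syz}(I_U)=\{(c_0,\dots,c_3)\in R^4:\sum c_ip_i=0\}$. A (first) syzygy of bidegree $(c,d)$ is a nonzero element of $\mathrm{syz}(I_U)$ all of whose entries lie in $R_{c,d}$. A linear syzygy is one of bidegree $(1,0)$ or $(0,1)$. $\langle\cdots\rangle$ denotes the $R$-submodule of $R^4$ generated by the listed syzygies, and $M_{c,d}=M\cap (R_{c,d})^4$ for a bigraded submodule $M\subseteq R^4$. Subspace $V$: write $Q=(a_iu^2+b_iuv+c_iv^2)_{i=0,\dots,3}$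 with $a_i,b_i,c_i\in k$, and put $f_0=\sum_i a_ip_i$, $f_1=\sum_i b_ip_i$, $f_2=\sum_i c_ip_i$. Then $V=\mathrm{Span}_k\{f_0,f_1,f_2\}\subseteq U$. *)

(* Defs.v *)
From HB Require Import structures.
From mathcomp Require Import all_boot all_order all_algebra.
From mathcomp Require Import mpoly.

Set Implicit Arguments.
Unset Strict Implicit.
Unset Printing Implicit Defensive.

Import GRing.Theory.

Local Open Scope ring_scope.

Section Dimension.

Variables (K : fieldType) (E : lmodType K).

Definition lincomb n (e : n.-tuple E) (c : 'I_n -> K) : E :=
  \sum_(i < n) c i *: tnth e i.

Definition in_span n (e : n.-tuple E) (x : E) : Prop :=
  exists c : 'I_n -> K, x = lincomb e c.

Definition lin_indep n (e : n.-tuple E) : Prop :=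
  forall c : 'I_n -> K, lincomb e c = 0 -> forall i, c i = 0.

Definition is_basis n (W : E -> Prop) (e : n.-tuple E) : Prop :=
  lin_indep e /\ (forall x, W x <-> in_span e x).

Definition has_dim (W : E -> Prop) (n : nat) : Prop :=
  exists e : n.-tuple E, is_basis W e.

End Dimension.

(* The variables s, t, u, v of R = k[s,t,u,v] are 'X_xs, 'X_xt, 'X_xu, 'X_xv. *)
Definition xs : 'I_4 := @Ordinal 4 0 isT.
Definition xt : 'I_4 := @Ordinal 4 1 isT.
Definition xu : 'I_4 := @Ordinal 4 2 isT.
Definition xv : 'I_4 := @Ordinal 4 3 isT.

Section Syzygies.

Variable k : fieldType.

Local Notation R := {mpoly k[4]}.
Local Notation R4 := {ffun 'I_4 -> {mpoly k[4]}}.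

(* Membership in R_{c,d}; in particular 0 belongs to every R_{c,d}. *)
Definition bihomog (c d : nat) (f : R) : Prop :=
  forall m : 'X_{1..4}, m \in msupp f ->
    (m xs + m xt = c)%N /\ (m xu + m xv = d)%N.

(* A point of P^1 x P^1 is given by homogeneous coordinates (x xs : x xt) and
   (x xu : x xv), neither pair being (0, 0). *)
Definition basepoint_free (p : 4.-tuple R) : Prop :=
  forall x : 'I_4 -> k,
    (x xs != 0) || (x xt != 0) -> (x xu != 0) || (x xv != 0) ->
    exists i : 'I_4, (tnth p i).@[x] != 0.

Definition syz (p : 4.-tuple R) (S : R4) : Prop :=
  \sum_(i < 4) S i * tnth p i = 0.

Definition syzygy_of_bidegree (p : 4.-tuple R) (c d : nat) (S : R4) : Prop :=
  [/\ syz p S, S != 0 & forall i, bihomog c d (S i)].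

Definition linear_syzygy (p : 4.-tuple R) (S : R4) : Prop :=
  syzygy_of_bidegree p 1 0 S \/ syzygy_of_bidegree p 0 1 S.

Definition submod_gen n (G : n.-tuple R4) (F : R4) : Prop :=
  exists r : 'I_n -> R, forall i, F i = \sum_(j < n) r j * tnth G j i.

Definition graded_part (M : R4 -> Prop) (c d : nat) (F : R4) : Prop :=
  M F /\ forall i, bihomog c d (F i).

(* \sum_i q_i p_i, where q_i is the coefficient of the monomial m in Q_i; for
   m = u^2, uv, v^2 this is f_0, f_1, f_2 respectively. *)
Definition coef_comb (p : 4.-tuple R) (Q : R4) (m : 'X_{1..4}) : R :=
  \sum_(i < 4) (Q i)@_m *: tnth p i.

Definition assoc_space (p : 4.-tuple R) (Q : R4) : R -> Prop :=
  in_span [tuple coef_comb p Q (U_(xu) + U_(xu));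
                 coef_comb p Q (U_(xu) + U_(xv));
                 coef_comb p Q (U_(xv) + U_(xv))].

End Syzygies.

(* Main.v *)
Require Import Defs.
From mathcomp Require Import all_boot all_order all_algebra.
From mathcomp Require Import mpoly.
From HB Require Import structures.
From mathcomp Require Import perm ring zify.

(* Write f_0 u^2 + f_1 uv + f_2 v^2 = 0 for the syzygy Q.  Looking modulo v
   and modulo u gives f_0 = g v, f_2 = h u, f_1 = - (g u + h v) with g, h of
   bidegree (a, b-1), and U is spanned by f_0, f_1, f_2 and a fourth form q.  A
   syzygy of (f_0, f_1, f_2, q) with entries c_j maps to the syzygy
   (c_0 v - c_1 u, c_2 u - c_1 v, c_3) of (g, h, q); this map kills Q and is
   onto in the relevant degrees because b >= 3, so the three Koszul syzygies of
   (g, h, q) lift to S_1, S_2, S_3.  The dimension count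
   2a(b-2) + 2a + a + a = 2ab amounts to the independence of Q, S_1, S_2, S_3
   in bidegree (2a-1, b-1), which reduces to: if gamma, delta in k[s,t] have
   degree a-1 and gamma g + delta h = 0 then gamma = delta = 0.  Otherwise g
   and h have a common factor w of positive degree in s, t, and the resultant
   of w and q with respect to s : t, a form of positive degree in u, v, has a
   zero on P^1, which yields a base point of U. *)

Set Implicit Arguments.
Unset Strict Implicit.
Unset Printing Implicit Defensive.

Import GRing.Theory.

Local Open Scope ring_scope.

(** * Bases indexed by finite types, and spanning families of minimal size *)

Section LinearAlgebra.

Variables (K : fieldType) (E : lmodType K).

(** An arbitrary finite index type is allowed so that a basis can be indexed by pairs of a generator
    and a monomial. *)
Lemma has_dim_fin (T : finType) (W : E -> Prop) (e : T -> E) :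
  (forall c : T -> K, \sum_t c t *: e t = 0 -> forall t, c t = 0) ->
  (forall x, W x <-> exists c : T -> K, x = \sum_t c t *: e t) ->
  has_dim W #|T|.
Proof.
move=> free span.
have sumE (c : 'I_#|T| -> K) :
    lincomb [tuple e (enum_val i) | i < #|T|] c
      = \sum_t c (enum_rank t) *: e t.
  rewrite /lincomb [RHS](reindex (@enum_val T predT)) /=; last first.
    by apply: onW_bij; apply: enum_val_bij.
  by apply: eq_bigr => i _; rewrite tnth_mktuple enum_valK.
exists [tuple e (enum_val i) | i < #|T|]; split.
  move=> c; rewrite sumE => /free c0 i.
  by rewrite -[i]enum_valK.
move=> x; split.
  case/span => c ->; exists (fun i => c (enum_val i)); rewrite sumE.
  by apply: eq_bigr => t _; rewrite enum_rankK.
case=> c ->; apply/span; exists (fun t => c (enum_rank t)); exact: sumE.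
Qed.

Lemma lincombE n (e : n.-tuple E) m (A : 'M[K]_(m, n)) (x : 'rV[K]_m) :
  \sum_i x 0 i *: lincomb e (A i) = lincomb e ((x *m A) 0).
Proof.
rewrite /lincomb.
under eq_bigr do rewrite scaler_sumr.
rewrite exchange_big; apply: eq_bigr => j _; rewrite mxE scaler_suml.
by apply: eq_bigr => i _; rewrite scalerA.
Qed.

(** Expanding [e] in a basis [f] and [f] in [e] gives square matrices with [MB *m MA = 1], hence
    [MA *m MB = 1], so the coefficient vector of a relation on [e] is killed by an invertible
    matrix. This turns dim V = 3 into the independence of f_0, f_1, f_2. *)
Lemma span_lin_indep n (e : n.-tuple E) : has_dim (in_span e) n -> lin_indep e.
Proof.
case=> f [free_f span_f].
have inf i : exists c : {ffun 'I_n -> K}, tnth e i = lincomb f c.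
  have /span_f [c ec] : in_span e (tnth e i).
    exists (fun j => (j == i)%:R).
    rewrite /lincomb (bigD1 i) //= eqxx scale1r big1 ?addr0 // => j /negPf->.
    by rewrite scale0r.
  exists [ffun j => c j]; rewrite ec /lincomb.
  by apply: eq_bigr => j _; rewrite ffunE.
have ine i : exists c : {ffun 'I_n -> K}, tnth f i = lincomb e c.
  have /span_f [c ec] : in_span f (tnth f i).
    exists (fun j => (j == i)%:R).
    rewrite /lincomb (bigD1 i) //= eqxx scale1r big1 ?addr0 // => j /negPf->.
    by rewrite scale0r.
  exists [ffun j => c j]; rewrite ec /lincomb.
  by apply: eq_bigr => j _; rewrite ffunE.
have [A eA] := fin_all_exists inf; have [B fB] := fin_all_exists ine.
pose MA : 'M[K]_n := \matrix_(i, j) A i j.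
pose MB : 'M[K]_n := \matrix_(i, j) B i j.
have eMA i : tnth e i = lincomb f (MA i).
  by rewrite eA /lincomb; apply: eq_bigr => j _; rewrite mxE.
have fMB i : tnth f i = lincomb e (MB i).
  by rewrite fB /lincomb; apply: eq_bigr => j _; rewrite mxE.
have BA : MB *m MA = 1%:M.
  apply/row_matrixP => i; apply/rowP => j; apply/eqP.
  rewrite -subr_eq0; apply/eqP.
  pose c j := row i (MB *m MA) 0 j - row i 1%:M 0 j.
  apply: (free_f c _ j); rewrite /c /lincomb.
  under eq_bigr do rewrite scalerBl.
  rewrite sumrB; apply/eqP; rewrite subr_eq0; apply/eqP.
  have /= := lincombE f MA (row i MB).
  rewrite -row_mul /lincomb => <-.
  transitivity (tnth f i).
    rewrite fMB /lincomb; apply: eq_bigr => l _; rewrite eMA; congr (_ *: _).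
    by rewrite mxE.
  rewrite (bigD1 i) //= big1 ?addr0 => [|l li]; rewrite !mxE ?eqxx ?scale1r //.
  by rewrite eq_sym (negPf li) scale0r.
move=> c c0 i.
pose x : 'rV[K]_n := \row_j c j.
have /free_f xA : lincomb f ((x *m MA) 0) = 0.
  rewrite -lincombE -[RHS]c0 [RHS]/lincomb; apply: eq_bigr => j _.
  by rewrite mxE eMA.
have x0 : x = 0.
  rewrite -[x]mulmx1 -(mulmx1C BA) mulmxA.
  suff -> : x *m MA = 0 by rewrite mul0mx.
  by apply/rowP => j; rewrite xA mxE.
by move/rowP/(_ i): x0; rewrite !mxE.
Qed.

End LinearAlgebra.

(** * Bihomogeneous forms: components and monomial bases *)

Section Bihomogeneous.

Variable k : fieldType.
Local Notation R := {mpoly k[4]}.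
Implicit Types (f g : R) (c d : nat).

Lemma sum4E (V : nmodType) (F : 'I_4 -> V) :
  \sum_i F i = F xs + F xt + F xu + F xv.
Proof.
rewrite !big_ord_recr big_ord0 /= add0r.
by congr (F _ + F _ + F _ + F _); apply: val_inj.
Qed.

Lemma prod4E (V : pzSemiRingType) (F : 'I_4 -> V) :
  \prod_i F i = F xs * F xt * F xu * F xv.
Proof.
rewrite !big_ord_recr big_ord0 /= mul1r.
by congr (F _ * F _ * F _ * F _); apply: val_inj.
Qed.

Lemma forall4 (P : 'I_4 -> Prop) :
  P xs -> P xt -> P xu -> P xv -> forall i, P i.
Proof.
move=> ps pt pu pv [[|[|[|[|i]]]] lti] //.
- by have -> : Ordinal lti = xs by apply: val_inj.
- by have -> : Ordinal lti = xt by apply: val_inj.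
- by have -> : Ordinal lti = xu by apply: val_inj.
- by have -> : Ordinal lti = xv by apply: val_inj.
Qed.

Lemma bihomog0 c d : bihomog c d (0 : R).
Proof. by move=> m; rewrite msupp0. Qed.

Lemma bihomogD c d f g :
  bihomog c d f -> bihomog c d g -> bihomog c d (f + g).
Proof.
move=> hf hg m /msuppD_le; rewrite mem_cat => /orP[/hf//|/hg//].
Qed.

Lemma bihomogZ c d (x : k) f : bihomog c d f -> bihomog c d (x *: f).
Proof. by move=> hf m /msuppZ_le /hf. Qed.

Lemma bihomogN c d f : bihomog c d f -> bihomog c d (- f).
Proof. by rewrite -scaleN1r; apply: bihomogZ. Qed.

Lemma bihomogB c d f g :
  bihomog c d f -> bihomog c d g -> bihomog c d (f - g).
Proof. by move=> hf hg; apply/bihomogD/bihomogN. Qed.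

Lemma bihomog_sum c d (I : Type) (r : seq I) (P : pred I) (F : I -> R) :
  (forall i, P i -> bihomog c d (F i)) -> bihomog c d (\sum_(i <- r | P i) F i).
Proof.
move=> hF; apply: big_ind => //; first exact: bihomog0.
by move=> x y; apply: bihomogD.
Qed.

Lemma bihomogM c d c' d' f g : bihomog c d f -> bihomog c' d' g ->
  bihomog (c + c') (d + d') (f * g).
Proof.
move=> hf hg m /msuppM_le /allpairsP [[m1 m2] /= [/hf [h1 h2] /hg [h3 h4] ->]].
by rewrite !mnmDE addnACA h1 h3 addnACA h2 h4.
Qed.

Lemma bihomogX (m : 'X_{1..4}) :
  bihomog (m xs + m xt) (m xu + m xv) ('X_[m] : R).
Proof. by move=> m'; rewrite msuppX inE => /eqP ->. Qed.
Arguments bihomogX : clear implicits.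

Lemma bihomog_eq c d c' d' f :
  bihomog c d f -> c = c' -> d = d' -> bihomog c' d' f.
Proof. by move=> hf <- <-. Qed.

Lemma bihomog_prod (I : Type) (r : seq I) (c d : I -> nat) (F : I -> R) :
  (forall i, bihomog (c i) (d i) (F i)) ->
  bihomog (\sum_(i <- r) c i) (\sum_(i <- r) d i) (\prod_(i <- r) F i).
Proof.
move=> hF; elim: r => [|i r IH]; last by rewrite !big_cons; apply: bihomogM.
rewrite !big_nil -mpolyX0; apply: bihomog_eq (bihomogX _) _ _;
  by rewrite !mnm0E.
Qed.

Lemma bihomogXU (i : 'I_4) : bihomog (i < 2) (1 < i) ('X_i : R).
Proof.
apply: bihomog_eq (bihomogX _) _ _; rewrite !mnm1E;
by elim/forall4: i.
Qed.
Arguments bihomogXU : clear implicits.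

(** The projection of R onto R_{c,d}. *)
Definition bicomp c d f : R :=
  \sum_(m <- msupp f | (m xs + m xt == c)%N && (m xu + m xv == d)%N)
    f@_m *: 'X_[m].

Lemma mcoeff_bicomp c d f (m : 'X_{1..4}) :
  (bicomp c d f)@_m =
    if (m xs + m xt == c)%N && (m xu + m xv == d)%N then f@_m else 0.
Proof.
rewrite /bicomp raddf_sum /=.
under eq_bigr do rewrite mcoeffZ mcoeffX.
case: ifP => [mcd|mcd]; last first.
  rewrite big1_seq // => m' /andP[m'cd _].
  case: eqP => [em|_]; rewrite ?mulr0 //.
  by rewrite em mcd in m'cd.
have [/memN_msupp_eq0 fm0|mf] := boolP (m \notin msupp f).
  rewrite fm0 big1 // => m' _.
  by case: eqP => [->|_]; rewrite ?fm0 ?mul0r ?mulr0.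
rewrite negbK in mf.
rewrite -big_filter (bigD1_seq m) ?mem_filter ?mcd ?filter_uniq ?msupp_uniq //=.
by rewrite eqxx mulr1 big1 ?addr0 // => m' /negPf->; rewrite mulr0.
Qed.

Lemma bicomp_bihomog c d f : bihomog c d (bicomp c d f).
Proof.
move=> m; rewrite mcoeff_msupp mcoeff_bicomp.
by case: ifP => [/andP[/eqP-> /eqP->]//|_]; rewrite eqxx.
Qed.

Lemma bicompD c d f g : bicomp c d (f + g) = bicomp c d f + bicomp c d g.
Proof.
by apply/mpolyP => m; rewrite mcoeffD !mcoeff_bicomp mcoeffD;
  case: ifP; rewrite ?addr0.
Qed.

Lemma bicompZ c d (x : k) f : bicomp c d (x *: f) = x *: bicomp c d f.
Proof.
by apply/mpolyP => m; rewrite mcoeffZ !mcoeff_bicomp mcoeffZ;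
  case: ifP; rewrite ?mulr0.
Qed.

Lemma bicomp0 c d : bicomp c d 0 = 0.
Proof. by rewrite /bicomp msupp0 big_nil. Qed.

Lemma bicomp_sum c d (I : Type) (r : seq I) (F : I -> R) :
  bicomp c d (\sum_(i <- r) F i) = \sum_(i <- r) bicomp c d (F i).
Proof.
apply: (big_morph (bicomp c d)); [exact: bicompD | exact: bicomp0].
Qed.

Lemma bicomp_bihomogE c d c' d' f : bihomog c' d' f ->
  bicomp c d f = if (c' == c) && (d' == d) then f else 0.
Proof.
move=> hf; apply/mpolyP => m; rewrite mcoeff_bicomp.
have [/memN_msupp_eq0 fm0|] := boolP (m \notin msupp f).
  by rewrite fm0; do 2 case: ifP => _; rewrite ?fm0 ?mcoeff0.
by rewrite negbK => /hf [-> ->]; case: ifP; rewrite ?mcoeff0.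
Qed.

(** By linearity [f] may be taken to be a monomial; its product with [G] is then bihomogeneous. *)
Lemma bicompMr c d e e' (f G : R) : bihomog e e' G ->
  bicomp (c + e) (d + e') (f * G) = bicomp c d f * G.
Proof.
move=> hG; rewrite [f]mpolyE mulr_suml !bicomp_sum mulr_suml.
apply: eq_bigr => m _; rewrite -scalerAl !bicompZ -scalerAl; congr (_ *: _).
rewrite (bicomp_bihomogE _ _ (bihomogM (bihomogX m) hG)).
rewrite (bicomp_bihomogE _ _ (bihomogX m)) !eqn_add2r.
by case: ifP; rewrite ?mul0r.
Qed.

(* s^i t^(c-i) u^j v^(d-j); meaningful for i <= c and j <= d only. *)
Definition bimon c d (i j : nat) : 'X_{1..4} :=
  [multinom nth 0%N [:: i; c - i; j; d - j]%N l | l < 4].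

Lemma bimonE c d i j : ((bimon c d i j xs = i) * (bimon c d i j xt = c - i)%N *
  (bimon c d i j xu = j) * (bimon c d i j xv = d - j)%N)%type.
Proof. by rewrite !mnmE. Qed.

Lemma eq_bimon c d (m : 'X_{1..4}) :
  (m xs + m xt)%N = c -> (m xu + m xv)%N = d ->
  m = bimon c d (m xs) (m xu).
Proof.
move=> <- <-; apply/mnmP; apply: forall4; rewrite !mnmE //= addKn //.
Qed.

Lemma bihomog_bimon c d i j :
  (i <= c)%N -> (j <= d)%N -> bihomog c d ('X_[bimon c d i j] : R).
Proof.
by move=> ic jd; apply: bihomog_eq (bihomogX _) _ _; rewrite !bimonE subnKC.
Qed.

Definition biform c d (x : 'I_c.+1 * 'I_d.+1 -> k) : R :=
  \sum_ij x ij *: 'X_[bimon c d ij.1 ij.2].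

Lemma biform_bihomog c d (x : 'I_c.+1 * 'I_d.+1 -> k) : bihomog c d (biform x).
Proof.
apply: bihomog_sum => -[i j] _; apply: bihomogZ; apply: bihomog_bimon;
  by rewrite -ltnS.
Qed.

Lemma mcoeff_biform c d (x : 'I_c.+1 * 'I_d.+1 -> k) 
    (i : 'I_c.+1) (j : 'I_d.+1) :
  (biform x)@_(bimon c d i j) = x (i, j).
Proof.
rewrite raddf_sum /= (bigD1 (i, j)) //= big1 => [|[i' j'] ne].
  by rewrite mcoeffZ mcoeffX eqxx mulr1 addr0.
rewrite mcoeffZ mcoeffX; case: eqP => [em|]; rewrite ?mulr0 //.
case/negP: ne; apply/eqP; congr (_, _); apply: val_inj.
  by move/mnmP/(_ xs): em; rewrite !bimonE.
by move/mnmP/(_ xu): em; rewrite !bimonE.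
Qed.

Lemma bihomog_biform c d f : bihomog c d f ->
  f = biform (fun ij : 'I_c.+1 * 'I_d.+1 => f@_(bimon c d ij.1 ij.2)).
Proof.
move=> hf; set g := biform _.
have hg : bihomog c d g by apply: biform_bihomog.
apply/mpolyP => m.
have [mcd|mcd] :=
    boolP ((m xs + m xt == c)%N && (m xu + m xv == d)%N); last first.
  rewrite !memN_msupp_eq0 //; apply: contra mcd.
    by case/hg => -> ->; rewrite !eqxx.
  by case/hf => -> ->; rewrite !eqxx.
case/andP: mcd => /eqP mc /eqP md.
have ltc : (m xs < c.+1)%N by rewrite ltnS -mc leq_addr.
have ltd : (m xu < d.+1)%N by rewrite ltnS -md leq_addr.
by rewrite (eq_bimon mc md) (mcoeff_biform _ (Ordinal ltc) (Ordinal ltd)).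
Qed.

Lemma biform0 c d (x : 'I_c.+1 * 'I_d.+1 -> k) :
  biform x = 0 -> forall ij, x ij = 0.
Proof. by move=> x0 [i j]; rewrite -mcoeff_biform x0 mcoeff0. Qed.

Lemma mcoeff_div0 i (f : R) (m : 'X_{1..4}) : m i = 0%N -> (f * 'X_i)@_m = 0.
Proof.
move=> mi; apply: memN_msupp_eq0.
rewrite (perm_mem (msuppMX _ _)); apply/negP => /mapP[m' _ em].
by move: mi; rewrite em mnmDE mnm1E eqxx.
Qed.

End Bihomogeneous.

Arguments bihomogX {k} m.
Arguments bihomogXU {k} i.

(** * Sylvester determinants with formal degrees *)

Section Sylvester.

(* Unlike [Sylvester_mx], this uses formal degrees c and a for W and Q, so that
   its determinant also vanishes when W and Q meet at the point at infinity. *)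
Definition sylvester (A : nzRingType) a c (W Q : {poly A}) : 'M[A]_(a + c) :=
  \matrix_(i, j) match split i with
                 | inl i1 => ('X^i1 * W)`_j
                 | inr i2 => ('X^i2 * Q)`_j
                 end.

Lemma map_sylvester (A B : nzRingType) (f : {rmorphism A -> B}) a c W Q :
  map_mx f (sylvester a c W Q) = sylvester a c (map_poly f W) (map_poly f Q).
Proof.
apply/matrixP => i j; rewrite !mxE.
by case: (split i) => i'; rewrite !coefXnM coef_map; case: ifP => _ //;
  rewrite rmorph0.
Qed.

(** A left kernel vector is a pair [A], [B] of degrees below a and c with [A * W + B * Q = 0]. If
    [W] and [Q] are coprime, then [W] divides [B] and [Q] divides [A], so a nonzero coefficient at
    either formal degree forces [A = B = 0]. *)
Lemma det_sylvester_eq0 (F : fieldType) a c (W Q : {poly F}) :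
  (size W <= c.+1)%N -> (size Q <= a.+1)%N -> \det (sylvester a c W Q) = 0 ->
  (W`_c = 0 /\ Q`_a = 0) \/ ~~ coprimep W Q.
Proof.
move=> sW sQ /eqP/det0P[v v0 vS].
pose A := \poly_(i < a) (if insub i is Some i' then v 0 (lshift c i') else 0).
pose B := \poly_(i < c) (if insub i is Some i' then v 0 (rshift a i') else 0).
have coefA (i : 'I_a) : A`_i = v 0 (lshift c i).
  rewrite coef_poly ltn_ord insubT // => lt.
  by congr (v _ (lshift _ _)); apply: val_inj.
have coefB (i : 'I_c) : B`_i = v 0 (rshift a i).
  rewrite coef_poly ltn_ord insubT // => lt.
  by congr (v _ (rshift _ _)); apply: val_inj.
have sA : (size A <= a)%N by apply: size_poly.
have sB : (size B <= c)%N by apply: size_poly.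
have smul (n m : nat) (f g : {poly F}) :
    (size f <= n)%N -> (size g <= m.+1)%N -> (size (f * g)%R <= n + m)%N.
  by move=> sf sg; have := size_polyMleq f g; lia.
have AB0 : A * W + B * Q = 0.
  apply/polyP => j; rewrite coef0.
  have [jac|jac] := ltnP j (a + c); last first.
    rewrite nth_default //; apply: leq_trans (size_polyD _ _) _.
    rewrite geq_max (leq_trans (smul _ _ _ _ sA sW) jac).
    by rewrite (leq_trans (smul _ _ _ _ sB sQ)) // addnC.
  have /rowP/(_ (Ordinal jac)) := vS; rewrite !mxE => vSj.
  rewrite -[RHS]vSj big_split_ord /= coefD; congr (_ + _).
    rewrite [A in A * W]poly_def mulr_suml coef_sum; apply: eq_bigr => i _.
    rewrite mxE (unsplitK (inl i)) -scalerAl coefZ; congr (_ * _).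
    by rewrite -coefA coef_poly ltn_ord.
  rewrite [B in B * Q]poly_def mulr_suml coef_sum; apply: eq_bigr => i _.
  rewrite mxE (unsplitK (inr i)) -scalerAl coefZ; congr (_ * _).
  by rewrite -coefB coef_poly ltn_ord.
have [cop|] := boolP (coprimep W Q); last by right.
left.
have AB_neq0 : A = 0 -> B = 0 -> False.
  move=> A0 B0; case/eqP: v0; apply/rowP => i; rewrite mxE -(splitK i).
  by case: (split i) => j /=; rewrite -?coefA -?coefB ?A0 ?B0 coef0.
have eqAB : A * W = - (B * Q) by apply/eqP; rewrite -addr_eq0 AB0.
have lead (n : nat) (f g : {poly F}) :
    (size f <= n.+1)%N -> (size g <= n)%N -> f`_n != 0 -> f %| g -> g = 0.
  move=> sf sg fn fg; apply/eqP; case: eqVneq => // g0.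
  have /leq_trans/(_ sg) := dvdp_leq g0 fg.
  by move=> /(nth_default 0) fn0; rewrite fn0 eqxx in fn.
split; apply/eqP/contraT => n0; exfalso.
  have B0 : B = 0.
    apply: (lead _ _ _ sW sB n0); rewrite -(Gauss_dvdpl B cop).
    by rewrite -dvdpNr -eqAB dvdp_mull.
  apply: AB_neq0 => //; move/eqP: eqAB; rewrite B0 mul0r oppr0 mulf_eq0.
  by case/orP => /eqP // W0; rewrite W0 coef0 eqxx in n0.
have A0 : A = 0.
  rewrite coprimep_sym in cop.
  apply: (lead _ _ _ sQ sA n0); rewrite -(Gauss_dvdpl A cop).
  by rewrite eqAB dvdpNr dvdp_mull.
apply: AB_neq0 => //; move/eqP: eqAB; rewrite A0 mul0r eq_sym oppr_eq0 mulf_eq0.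
by case/orP => /eqP // W0; rewrite W0 coef0 eqxx in n0.
Qed.

End Sylvester.

(** * Dehomogenization in s : t and evaluation at points *)

Section Dehomogenization.

Variable k : fieldType.
Local Notation R := {mpoly k[4]}.
Implicit Types (f g : R) (c d : nat).

(* t = 1, and s becomes the variable of {poly R}. *)
Definition dehom_var (i : 'I_4) : {poly R} :=
  nth 0 [:: 'X; 1; ('X_xu)%:P; ('X_xv)%:P] i.

Definition dehom : R -> {poly R} := mmap (polyC \o @mpolyC 4 k) dehom_var.

HB.instance Definition _ := GRing.RMorphism.on dehom.

Lemma dehom0 : dehom 0 = 0. Proof. exact: rmorph0. Qed.

Lemma dehomD f g : dehom (f + g) = dehom f + dehom g.
Proof. exact: rmorphD. Qed.

Lemma dehomM f g : dehom (f * g) = dehom f * dehom g.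
Proof. exact: rmorphM. Qed.

Lemma coef_dehom f i : (dehom f)`_i =
  \sum_(m <- msupp f | m xs == i) f@_m *: ('X_xu ^+ m xu * 'X_xv ^+ m xv).
Proof.
rewrite /dehom /mmap coef_sum [RHS]big_mkcond; apply: eq_bigr => m _.
rewrite /mmap1 prod4E /dehom_var /= coefCM expr1n mulr1 -!rmorphXn /=.
rewrite -mulrA -rmorphM /= coefMC coefXn mul_mpolyC eq_sym.
by case: eqP; rewrite ?mul1r ?mul0r ?scaler0.
Qed.

Lemma dehom_bihomog c d f i : bihomog c d f -> bihomog 0 d (dehom f)`_i.
Proof.
move=> hf; rewrite coef_dehom big_seq_cond.
apply: bihomog_sum => m /andP[/hf[_ md] _]; apply: bihomogZ.
rewrite !mpolyXn -mpolyXD.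
apply: bihomog_eq (bihomogX _) _ _;
  by rewrite !mnmDE !mulmnE !mnm1E /= ?muln0 ?muln1 ?mul1n ?mul0n ?addn0.
Qed.

Lemma size_dehom c d f : bihomog c d f -> (size (dehom f) <= c.+1)%N.
Proof.
move=> hf; apply/leq_sizeP => i ci; rewrite coef_dehom big_seq_cond big1 //.
by move=> m /andP[/hf[mc _] /eqP mi]; lia.
Qed.

(** Setting t = 1 loses nothing, since the exponent of t is c minus that of s. *)
Lemma dehomK c d f : bihomog c d f ->
  f = \sum_(i < c.+1) (dehom f)`_i * 'X_xs ^+ i * 'X_xt ^+ (c - i).
Proof.
move=> hf; rewrite {1}[f]mpolyE.
under [RHS]eq_bigr do
  rewrite coef_dehom -mulrA mulr_suml big_mkcond /=.
rewrite exchange_big big_seq_cond [RHS]big_seq_cond.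
apply: eq_bigr => m; rewrite andbT => /hf[mc md].
have msc : (m xs < c.+1)%N by rewrite ltnS -mc leq_addr.
rewrite (bigD1 (Ordinal msc)) //= eqxx big1 => [|i im]; last first.
  by rewrite ifN // eq_sym.
rewrite addr0 -scalerAl [in LHS]mpolyXE_id prod4E; congr (_ *: _).
have -> : (c - m xs = m xt)%N by lia.
ring.
Qed.

Lemma dehom_eq0 c d f : bihomog c d f -> dehom f = 0 -> f = 0.
Proof.
move=> hf f0; rewrite (dehomK hf); apply: big1 => i _.
by rewrite f0 coef0 !mul0r.
Qed.

Definition pt (s t u v : k) (i : 'I_4) : k := nth 0 [:: s; t; u; v] i.

(** Lets the single morphism [meval (pt 0 0 u v)] evaluate the coefficients of a dehomogenized form,
    whatever s and t are. *)
Lemma meval_bihomog0 d f s t u v :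
  bihomog 0 d f -> f.@[pt s t u v] = f.@[pt 0 0 u v].
Proof.
move=> hf; rewrite !mevalE; apply: eq_big_seq => m /hf[/eqP].
rewrite addn_eq0 => /andP[/eqP ms /eqP mt] _.
by rewrite !prod4E ms mt !expr0.
Qed.

Lemma meval_dehom c d f s t u v : bihomog c d f ->
  f.@[pt s t u v] =
  \sum_(i < c.+1) ((dehom f)`_i).@[pt 0 0 u v] * s ^+ i * t ^+ (c - i).
Proof.
move=> hf; rewrite {1}(dehomK hf) raddf_sum /=; apply: eq_bigr => i _.
rewrite !rmorphM !rmorphXn /= !mevalXU /pt /=.
by rewrite (meval_bihomog0 _ _ _ _ (dehom_bihomog hf)).
Qed.

Lemma meval_dehom1 c d f s u v : bihomog c d f ->
  f.@[pt s 1 u v] = (map_poly (meval (pt 0 0 u v)) (dehom f)).[s].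
Proof.
move=> hf; rewrite (meval_dehom _ _ _ _ hf).
rewrite (horner_coef_wide _ (leq_trans (size_poly _ _) (size_dehom hf))).
by apply: eq_bigr => i _; rewrite coef_map expr1n mulr1.
Qed.

(** At t = 0 only the term in s^c survives, so the coefficient at the formal degree detects
    vanishing at (1 : 0). *)
Lemma meval_dehom0 c d f u v : bihomog c d f ->
  f.@[pt 1 0 u v] = (map_poly (meval (pt 0 0 u v)) (dehom f))`_c.
Proof.
move=> hf; rewrite (meval_dehom _ _ _ _ hf) coef_map /=.
rewrite big_ord_recr /= subnn mulr1 expr1n mulr1 big1 ?add0r // => i _.
by rewrite -(subnSK (ltn_ord i)) exprS mul0r mulr0.
Qed.

(** Each term of the Leibniz expansion takes one entry from every row, so the row degrees add up. *)
Lemma bihomog_det d (n : nat) (r : 'I_n -> nat) (M : 'M[R]_n) :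
  (forall i j, bihomog d (r i) (M i j)) ->
  bihomog (n * d) (\sum_i r i) (\det M).
Proof.
move=> hM; apply: bihomog_sum => s _.
have hprod : bihomog (n * d) (\sum_i r i) (\prod_i M i (s i)).
  apply: bihomog_eq (bihomog_prod (fun i => hM i (s i))) _ _ => //.
  by rewrite sum_nat_const card_ord.
rewrite mulr_sign; case: ifP => _ //; exact: bihomogN.
Qed.

(** The coefficients have bidegree (0, 0), hence are constants. Moving to [{poly k}] makes gcds and
    Bezout relations available. *)
Lemma dehom_const c f : bihomog c 0 f ->
  {f0 : {poly k} | map_poly (@mpolyC 4 k) f0 = dehom f}.
Proof.
move=> hf; exists (\poly_(i < size (dehom f)) ((dehom f)`_i)@_0%MM).
apply/polyP => i; rewrite coef_map coef_poly /=.
case: ltnP => ilt; last by rewrite nth_default // mpolyC0.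
have h0 := dehom_bihomog hf.
apply/mpolyP => m; rewrite mcoeffC.
have [->|m0] := eqVneq m 0%MM; first by rewrite mulr1.
rewrite mulr0; apply/esym/memN_msupp_eq0; apply: contra m0 => /h0[/eqP + /eqP].
rewrite !addn_eq0 => /andP[/eqP ms /eqP mt] /andP[/eqP mu /eqP mv].
by apply/eqP/mnmP; apply: forall4; rewrite mnm0E.
Qed.

End Dehomogenization.

(** * Zeros of binary forms over an algebraically closed field *)

Section ClosedField.

Variable k : closedFieldType.
Local Notation R := {mpoly k[4]}.

Lemma closed_root_gcd (F : closedFieldType) (p q : {poly F}) :
  ~~ coprimep p q -> exists x, root p x /\ root q x.
Proof. by case/closed_rootP => x; rewrite root_gcd => /andP[? ?]; exists x. Qed.

(** If the coefficient of u^d vanishes, (1 : 0) is a zero; otherwise setting v = 1 leaves a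
    polynomial of degree d > 0, which has a root. *)
Lemma bihomog0_root (d : nat) (f : R) : (0 < d)%N -> bihomog 0 d f ->
  exists u v, ((u != 0) || (v != 0)) /\ f.@[pt 0 0 u v] = 0.
Proof.
move=> d0 hf.
pose F := \poly_(j < d.+1) f@_(bimon 0 d 0 j).
have evF u v : f.@[pt 0 0 u v] =
    \sum_(j < d.+1) f@_(bimon 0 d 0 j) * (u ^+ j * v ^+ (d - j)).
  rewrite {1}(bihomog_biform hf) /biform raddf_sum /=.
  rewrite -(pair_bigA _ (fun (i : 'I_1) (j : 'I_d.+1) =>
     meval (pt 0 0 u v) (f@_(bimon 0 d i j) *: 'X_[bimon 0 d i j]))) /=.
  rewrite big_ord1; apply: eq_bigr => j _.
  by rewrite mevalZ mevalX prod4E !bimonE /pt /= !expr0 !mul1r.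
have [Fd|Fd] := eqVneq (F`_d) 0.
  exists 1, 0; split; first by rewrite oner_eq0.
  rewrite evF big_ord_recr /= big1 => [|i _]; last first.
    by rewrite -(subnSK (ltn_ord i)) exprS mul0r !mulr0.
  by move: Fd; rewrite coef_poly ltnSn => ->; rewrite mul0r addr0.
have /closed_rootP[u /rootP Fu] : size F != 1%N.
  by apply: contra_neq Fd => sF; rewrite nth_default // sF.
exists u, 1; split; first by rewrite oner_eq0 orbT.
rewrite evF -[RHS]Fu horner_poly; apply: eq_bigr => j _.
by rewrite expr1n mulr1.
Qed.

End ClosedField.

(** * Common zeros of g, h, q through a resultant *)

Section CommonZeros.

Lemma cancel_factor (A : idomainType) (e z w g h : A) :
  e != 0 -> z * e * g + w * e * h = 0 -> z * g + w * h = 0.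
Proof.
move=> e0 rel; apply: (mulfI e0); rewrite mulr0 -rel; ring.
Qed.

(** For coprime [z] and [w], the relation forces [g] and [h] to share the factor [y * g - x * h],
    with cofactors [w] and [- z]. *)
Lemma bezout_factor (A : comNzRingType) (x y z w g h : A) :
  x * z + y * w = 1 -> z * g + w * h = 0 ->
  w * (y * g - x * h) = g /\ z * (y * g - x * h) = - h.
Proof.
move=> bez rel; split.
  transitivity ((x * z + y * w) * g - x * (z * g + w * h)); first by ring.
  by rewrite bez rel mul1r mulr0 subr0.
transitivity (- ((x * z + y * w) * h) + y * (z * g + w * h)); first by ring.
by rewrite bez rel mul1r mulr0 addr0.
Qed.

Variable k : closedFieldType.
Local Notation R := {mpoly k[4]}.
Local Notation up := (map_poly (@mpolyC 4 k)).

(** The formal resultant of [W] and [q] is a form of positive degree in u, v, so it vanishes at some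
    (u : v). Over that point either both top coefficients vanish, which is a common zero at (1 : 0),
    or a common root s gives one at (s : 1). *)
Lemma resultant_zero a b c d (W : {poly R}) (q : R) :
  (0 < a)%N -> (0 < b)%N -> (0 < c)%N ->
  (size W <= c.+1)%N -> (forall i, bihomog 0 d W`_i) -> bihomog a b q ->
  exists u v, ((u != 0) || (v != 0)) /\
   let ev := map_poly (meval (pt 0 0 u v)) in
   (((ev W)`_c = 0 /\ q.@[pt 1 0 u v] = 0) \/
    (exists s, root (ev W) s /\ q.@[pt s 1 u v] = 0)).
Proof.
move=> a0 b0 c0 sW hW hq.
pose D := \det (sylvester a c W (dehom q)).
pose r (i : 'I_(a + c)) := if split i is inl _ then d else b.
have hD : bihomog 0 (\sum_i r i) D.
  rewrite -[X in bihomog X](muln0 (a + c)); apply: bihomog_det => i j.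
  rewrite mxE /r; case: (split i) => i'; rewrite coefXnM;
    case: ifP => _; try exact: bihomog0; first exact: hW.
  exact: (dehom_bihomog hq).
(* Since c > 0, some row consists of coefficients of [q], which have degree b > 0; the degree d of
   the other rows may be 0. *)
have rpos : (0 < \sum_i r i)%N.
  rewrite (bigD1 (rshift a (Ordinal c0))) //= /r (unsplitK (inr _)).
  by rewrite addn_gt0 b0.
have [u [v [uv0 Duv]]] := bihomog0_root rpos hD.
exists u, v; split=> //=.
pose ev := map_poly (meval (pt 0 0 u v)).
have : \det (sylvester a c (ev W) (ev (dehom q))) = 0.
  by rewrite -map_sylvester det_map_mx.
case/det_sylvester_eq0.
- exact: leq_trans (size_poly _ _) sW.
- exact: leq_trans (size_poly _ _) (size_dehom hq).
- by rewrite -(meval_dehom0 _ _ hq); left.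
case/closed_root_gcd => s [rW rq]; right; exists s; split=> //.
by rewrite (meval_dehom1 _ _ _ hq); apply/rootP.
Qed.

Lemma syzygy_st_eq0 a b d (g h q ga de : R) :
  (0 < a)%N -> (0 < b)%N ->
  bihomog a d g -> bihomog a d h -> bihomog a b q ->
  (forall s t u v, (s != 0) || (t != 0) -> (u != 0) || (v != 0) ->
     g.@[pt s t u v] = 0 -> h.@[pt s t u v] = 0 -> q.@[pt s t u v] = 0 ->
     False) ->
  bihomog a.-1 0 ga -> bihomog a.-1 0 de -> ga * g + de * h = 0 ->
  ga = 0 /\ de = 0.
Proof.
move=> a0 b0 hg hh hq nobase hga hde rel.
have [ga0 ga0E] := dehom_const hga; have [de0 de0E] := dehom_const hde.
have sga : (size ga0 <= a)%N.
  by rewrite -(size_map_poly (@mpolyC 4 k)) ga0E -(prednK a0) (size_dehom hga).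
have sde : (size de0 <= a)%N.
  by rewrite -(size_map_poly (@mpolyC 4 k)) de0E -(prednK a0) (size_dehom hde).
have [nz|] := boolP ((ga0 != 0) || (de0 != 0)); last first.
  rewrite negb_or !negbK => /andP[/eqP ga00 /eqP de00].
  by split; [apply: (dehom_eq0 hga); rewrite -ga0E ga00 rmorph0 |
             apply: (dehom_eq0 hde); rewrite -de0E de00 rmorph0].
exfalso.
(* The pair is made coprime to allow a Bezout relation; [e] is nonzero because [ga0] and [de0] are
   not both zero. *)
pose e := gcdp ga0 de0; pose ga1 := ga0 %/ e; pose de1 := de0 %/ e.
have e0 : e != 0 by rewrite gcdp_eq0 negb_and.
have ga1E : ga1 * e = ga0 by rewrite divpK // dvdp_gcdl.
have de1E : de1 * e = de0 by rewrite divpK // dvdp_gcdr.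
have sfac (z z0 : {poly k}) : z * e = z0 -> (size z <= size z0)%N.
  move=> <-; have [->|z00] := eqVneq z 0; first by rewrite size_poly0.
  by rewrite dvdp_leq ?mulf_neq0 // dvdp_mulr.
have sga1 : (size ga1 <= a)%N := leq_trans (sfac _ _ ga1E) sga.
have sde1 : (size de1 <= a)%N := leq_trans (sfac _ _ de1E) sde.
have /Bezout_eq1_coprimepP[[x y] /= bez] : coprimep ga1 de1.
  exact: coprimep_div_gcd.
pose G := dehom g; pose H := dehom h.
have gaM : up ga0 = up ga1 * up e by rewrite -ga1E rmorphM.
have deM : up de0 = up de1 * up e by rewrite -de1E rmorphM.
have rel0 : up ga0 * G + up de0 * H = 0.
  transitivity (dehom (ga * g + de * h)); last by rewrite rel dehom0.
  by rewrite dehomD !dehomM ga0E de0E.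
have relGH : up ga1 * G + up de1 * H = 0.
  apply: (@cancel_factor _ (up e)); first by rewrite map_poly_eq0.
  by rewrite -gaM -deM.
have upbez : up x * up ga1 + up y * up de1 = 1.
  by have := congr1 up bez; rewrite rmorphD rmorph1 !rmorphM.
(* The common factor: [G = up de1 * W] and [H = - (up ga1 * W)]. *)
pose W := up y * G - up x * H.
have [WG WH] := bezout_factor upbez relGH; rewrite -/W in WG WH.
(* The larger of the two cofactor degrees. As it is below a, the factor [W] gets the positive formal
   degree [a - n]. *)
pose n := (maxn (size ga1) (size de1)).-1.
have na : (n < a)%N by rewrite /n; lia.
have arith r m : (r < a -> r + m <= a.+1 -> m <= (a - r).+1)%N by lia.
have sW : (size W <= (a - n).+1)%N.
  have [->|W0] := eqVneq W 0; first by rewrite size_poly0.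
  have szup (z : {poly k}) : z != 0 -> (size (up z * W)%R <= a.+1)%N ->
      ((size z).-1 + size W <= a.+1)%N.
    move=> z0; rewrite size_mul ?map_poly_eq0 // size_map_poly.
    by rewrite (polySpred z0) addSn.
  (* The cofactor of degree exactly n bounds the size of [W], because its product with [W] is [G] or
     [- H], of degree at most a. *)
  have [le|lt] := leqP (size ga1) (size de1).
    have de10 : de1 != 0.
      rewrite -size_poly_gt0; apply: contraT; rewrite -leqNgt leqn0 => s0.
      have /eqP de10 := s0; rewrite size_poly_eq0 in s0.
      move: le; rewrite de10 leqn0 size_poly_eq0 => /eqP ga10.
      by move: nz; rewrite -ga1E -de1E ga10 (eqP s0) mul0r eqxx.
    have := szup _ de10; rewrite WG (size_dehom hg) => /(_ isT).
    by move: na; rewrite /n (maxn_idPr le) => na /(arith _ _ na).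
  have ga10 : ga1 != 0 by rewrite -size_poly_gt0; apply: leq_ltn_trans lt.
  have := szup _ ga10; rewrite WH size_polyN (size_dehom hh) => /(_ isT).
  by move: na; rewrite /n (maxn_idPl (ltnW lt)) => na /(arith _ _ na).
have hup (z : {poly k}) i : bihomog 0 0 (up z)`_i.
  rewrite coef_map /= -[_%:MP]mulr1 mul_mpolyC -mpolyX0; apply: bihomogZ.
  by apply: bihomog_eq (bihomogX _) _ _; rewrite !mnm0E.
have hup_mul (z : {poly k}) (f : R) i :
    bihomog a d f -> bihomog 0 d (up z * dehom f)`_i.
  move=> hf; rewrite coefM; apply: bihomog_sum => j _.
  exact: (bihomogM (hup _ _) (dehom_bihomog hf)).
have hW i : bihomog 0 d W`_i.
  by rewrite coefB; apply: bihomogB; apply: hup_mul.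
have c0 : (0 < a - n)%N by rewrite subn_gt0.
have [u [v [uv0 /= evs]]] := resultant_zero a0 b0 c0 sW hW hq.
move: evs; set ev := map_poly (meval (pt 0 0 u v)).
have evM F1 F2 : ev (F1 * F2) = ev F1 * ev F2.
  exact: (rmorphM (map_poly (meval (pt 0 0 u v)))).
have evN F1 : ev (- F1) = - ev F1.
  exact: (rmorphN (map_poly (meval (pt 0 0 u v)))).
have evH : ev H = - (ev (up ga1) * ev W) by rewrite -evM WH evN opprK.
have evG : ev G = ev (up de1) * ev W by rewrite -evM WG.
(* A root s of [W] gives the base point (s : 1); the point (1 : 0) is treated afterwards. *)
case=> [[Wc q0]|[s [/rootP Ws q0]]]; last first.
  apply: (nobase s 1 u v) => //; first by rewrite oner_eq0 orbT.
    by rewrite (meval_dehom1 _ _ _ hg) -/ev -/G evG hornerM Ws mulr0.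
  rewrite (meval_dehom1 _ _ _ hh) -/ev -/H evH.
  by rewrite hornerN hornerM Ws mulr0 oppr0.
have sWc : (size (ev W) <= a - n)%N.
  apply/leq_sizeP => j; rewrite leq_eqVlt => /orP[/eqP<- //|jlt].
  by rewrite nth_default // (leq_trans _ jlt) // (leq_trans (size_poly _ _)).
(* Once the coefficient of [W] at [a - n] vanishes, multiplying by a polynomial of degree at most n
   stays below degree a, so [g] and [h] vanish at (1 : 0). *)
have topc (z : {poly k}) : (size z <= n.+1)%N -> (ev (up z) * ev W)`_a = 0.
  move=> sz; rewrite nth_default //.
  apply: leq_trans (size_polyMleq _ _) _.
  have : (size (ev (up z)) <= size z)%N.
    by rewrite (leq_trans (size_poly _ _)) // size_map_poly.
  by move: na sz sWc; move: (size (ev W)) (size (ev _)) => *; lia.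
apply: (nobase 1 0 u v) => //; first by rewrite oner_eq0.
  rewrite (meval_dehom0 _ _ hg) -/ev -/G evG topc //.
  exact: leq_trans (leq_maxr _ _) (leqSpred _).
rewrite (meval_dehom0 _ _ hh) -/ev -/H evH coefN topc ?oppr0 //.
exact: leq_trans (leq_maxl _ _) (leqSpred _).
Qed.

End CommonZeros.

(** * Dimension of a graded piece from independence in that bidegree *)

Section FreeModule.

Variable k : fieldType.
Local Notation R := {mpoly k[4]}.
Local Notation R4 := {ffun 'I_4 -> R}.

(** The bidegree [(x l, y l)] complements that of generator [l] in (c, d). Independence over
    coefficients of these bidegrees makes the products of monomials and generators a basis, and each
    summand counts monomials. *)
Lemma dim_graded_part_free n (G : n.-tuple R4) (x y e f : 'I_n -> nat) c d :
  (forall l, (x l + e l = c)%N) -> (forall l, (y l + f l = d)%N) ->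
  (forall l i, bihomog (e l) (f l) (tnth G l i)) ->
  (forall r : 'I_n -> R, (forall l, bihomog (x l) (y l) (r l)) ->
     (forall i, \sum_l r l * tnth G l i = 0) -> forall l, r l = 0) ->
  has_dim (graded_part (submod_gen G) c d)
    (\sum_l (x l).+1 * (y l).+1).
Proof.
move=> xe yf hG free.
pose J l : finType := ('I_(x l).+1 * 'I_(y l).+1)%type.
pose T := {l : 'I_n & J l}.
pose E (t : T) : R4 :=
  [ffun i => 'X_[bimon (x (tag t)) (y (tag t)) (tagged t).1 (tagged t).2]
              * tnth G (tag t) i].
have sumE (w : T -> k) i : (\sum_t w t *: E t) i =
    \sum_l @biform k (x l) (y l) (fun ij => w (Tagged J ij)) * tnth G l i.
  rewrite sum_ffunE.
  transitivity (\sum_l \sum_(ij : J l)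
      w (Tagged J ij) *: 'X_[bimon (x l) (y l) ij.1 ij.2] * tnth G l i);
    last first.
    by apply: eq_bigr => l _; rewrite /biform mulr_suml.
  rewrite (sig_big_dep _ (fun (l : 'I_n) (_ : J l) => true)
    (fun l (ij : J l) => (w (Tagged J ij) *: 'X_[bimon (x l) (y l) ij.1 ij.2])
                    * tnth G l i)) /=.
  by apply: eq_bigr => -[l ij] _; rewrite !ffunE -scalerAl.
have <- : #|{: T}| = (\sum_l (x l).+1 * (y l).+1)%N.
  rewrite card_tagged sumnE big_map big_enum; apply: eq_bigr => l _.
  by rewrite card_prod !card_ord.
apply: (has_dim_fin (e := E)).
  move=> w w0 [l ij].
  apply: (biform0 (x := fun ij => w (Tagged J ij))).
  apply: (free (fun l => @biform k (x l) (y l) (fun ij => w (Tagged J ij)))).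
    move=> l'; exact: biform_bihomog.
  by move=> i; rewrite -sumE w0 ffunE.
move=> F; split; last first.
  case=> w ->; split.
    exists (fun l => @biform k (x l) (y l) (fun ij => w (Tagged J ij))) => i.
    exact: sumE.
  move=> i; rewrite sumE; apply: bihomog_sum => l _.
  by rewrite -(xe l) -(yf l); apply: bihomogM => //; apply: biform_bihomog.
case=> -[r Fr] hF.
(* The coefficients [r l] need not be homogeneous; only their components of bidegree [(x l, y l)]
   contribute to [F], which lies in bidegree (c, d). *)
exists (fun t : T => (r (tag t))@_
  (bimon (x (tag t)) (y (tag t)) (tagged t).1 (tagged t).2)).
apply/ffunP => i; rewrite sumE.
have -> : F i = bicomp c d (F i).
  by rewrite (bicomp_bihomogE _ _ (hF i)) !eqxx.
rewrite Fr bicomp_sum; apply: eq_bigr => l _.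
rewrite -{1}(xe l) -{1}(yf l) (bicompMr _ _ _ (hG l i)); congr (_ * _).
rewrite [LHS](bihomog_biform (@bicomp_bihomog k _ _ _)).
apply: eq_bigr => -[i1 j1] _ /=; congr (_ *: _).
by rewrite mcoeff_bicomp !bimonE !subnKC ?eqxx // -ltnS.
Qed.

End FreeModule.

(** * Division by u and v, and lifting along the map that kills Q *)

Section Lifting.

Variable k : fieldType.
Local Notation R := {mpoly k[4]}.
Local Notation u := ('X_xu : R).
Local Notation v := ('X_xv : R).

Lemma bihomog_xu : bihomog 0 1 u. Proof. exact: (bihomogXU xu). Qed.
Lemma bihomog_xv : bihomog 0 1 v. Proof. exact: (bihomogXU xv). Qed.

Lemma bihomogXn c d (f : R) n :
  bihomog c d f -> bihomog (c * n) (d * n) (f ^+ n).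
Proof.
move=> hf; elim: n => [|n IH]; last by rewrite exprS !mulnS; apply: bihomogM.
rewrite expr0 !muln0 -mpolyX0; apply: bihomog_eq (bihomogX _) _ _;
  by rewrite !mnm0E.
Qed.

(** Monomials containing ['X_y] are divided by it; the others have full degree d + 1 in ['X_x]. Here
    [x], [y] index u and v in either order. *)
Lemma bihomog_split (x y : 'I_4) c d (f : R) :
  (x, y) = (xu, xv) \/ (x, y) = (xv, xu) -> bihomog c d.+1 f ->
  exists f' al, [/\ bihomog c d f', bihomog c 0 al &
                    f = f' * 'X_y + al * 'X_x ^+ d.+1].
Proof.
move=> xy hf.
have yx : y <> x by case: xy => -[-> ->].
have deg (m : 'X_{1..4}) : (m xu + m xv = m x + m y)%N.
  by case: xy => -[-> ->] //; rewrite addnC.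
have st i : i = xs \/ i = xt -> (x != i) && (y != i).
  by case: xy => -[-> ->] [->|->].
have [xns yns] : x != xs /\ y != xs by apply/andP/st; left.
have [xnt ynt] : x != xt /\ y != xt by apply/andP/st; right.
exists (\sum_(m <- msupp f | (0 < m y)%N) f@_m *: 'X_[m - U_(y)]).
exists (\sum_(m <- msupp f | ~~ (0 < m y)%N) f@_m *: 'X_[m - U_(x) *+ d.+1]).
split.
- rewrite big_seq_cond; apply: bihomog_sum => m /andP[/hf[mc md] my].
  apply: bihomogZ; apply: bihomog_eq (bihomogX _) _ _.
    by rewrite !mnmBE !mnm1E (negPf yns) (negPf ynt) !subn0.
  rewrite deg !mnmBE !mnm1E eqxx (introF eqP yx) subn0.
  by move: md; rewrite deg; lia.
- rewrite big_seq_cond; apply: bihomog_sum => m /andP[/hf[mc md] my].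
  apply: bihomogZ; apply: bihomog_eq (bihomogX _) _ _.
    by rewrite !mnmBE !mulmnE !mnm1E (negPf xns) (negPf xnt) !subn0.
  rewrite deg !mnmBE !mulmnE !mnm1E eqxx mul1n.
  by move: md; rewrite deg; lia.
rewrite {1}[f]mpolyE (bigID (fun m : 'X_{1..4} => 0 < m y)%N) /= !mulr_suml.
congr (_ + _).
  apply: eq_bigr => m my; rewrite -scalerAl -mpolyXD submK //.
  by apply/mnm_lepP => i; rewrite mnm1E; case: eqP => // <-.
rewrite big_seq_cond [RHS]big_seq_cond.
apply: eq_bigr => m /andP[/hf[mc md] my].
rewrite -scalerAl mpolyXn -mpolyXD submK //.
apply/mnm_lepP => i; rewrite mulmnE mnm1E; case: eqP => // <-.
by move: md; rewrite deg; lia.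
Qed.

(** No monomial on the left of the equation involves ['X_y], while every monomial on the right
    does. *)
Lemma pure_coef_eq0 (x y : 'I_4) c n (al w : R) :
  (x, y) = (xu, xv) \/ (x, y) = (xv, xu) -> bihomog c 0 al ->
  al * 'X_x ^+ n = w * 'X_y -> al = 0.
Proof.
move=> xy hal eq_al; apply/mpolyP => m; rewrite mcoeff0.
have [/memN_msupp_eq0 //|] := boolP (m \notin msupp al).
rewrite negbK => /hal[_ /eqP]; rewrite addn_eq0 => /andP[/eqP mu /eqP mv].
rewrite -(mcoeffMX _ (U_(x) *+ n)%MM) -mpolyXn addmC eq_al mcoeff_div0 //.
by rewrite mnmDE mulmnE mnm1E; case: xy => -[-> ->]; rewrite ?mu ?mv.
Qed.

Lemma syzygy_uv c d (f0 f1 f2 : R) :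
  bihomog c d.+1 f0 -> bihomog c d.+1 f2 ->
  f0 * u ^+ 2 + f1 * (u * v) + f2 * v ^+ 2 = 0 ->
  exists g h, [/\ bihomog c d g, bihomog c d h &
    [/\ f0 = g * v, f1 = - (g * u + h * v) & f2 = h * u]].
Proof.
move=> h0 h2 rel.
have xyu : (xu, xv) = (xu, xv) \/ (xu, xv) = (xv, xu) by left.
have xyv : (xv, xu) = (xu, xv) \/ (xv, xu) = (xv, xu) by right.
have [g [al [hg hal f0E]]] := bihomog_split xyu h0.
have [h [be [hh hbe f2E]]] := bihomog_split xyv h2.
have al0 : al = 0.
  (* After substituting f_0 = g v + al u^(d+1), the term al u^(d+3) is the only one without a
     visible factor v. *)
  apply: (pure_coef_eq0 (n := d.+3)
    (w := - (g * u ^+ 2 + f1 * u + f2 * v)) xyu hal).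
  apply/eqP; rewrite -subr_eq0 -rel f0E !exprS; apply/eqP; ring.
have be0 : be = 0.
  apply: (pure_coef_eq0 (n := d.+3)
    (w := - (h * v ^+ 2 + f1 * v + f0 * u)) xyv hbe).
  apply/eqP; rewrite -subr_eq0 -rel f2E !exprS; apply/eqP; ring.
move: f0E f2E; rewrite al0 be0 !mul0r !addr0 => f0E f2E.
exists g, h; split=> //; split=> //.
(* f_1 is recovered by cancelling uv in the relation. *)
have uv0 : u * v != 0.
  by rewrite -mpolyXD -msupp_eq0 msuppX.
apply: (mulIf uv0); apply/eqP; rewrite -subr_eq0 -rel f0E f2E; apply/eqP; ring.
Qed.

(** Surjectivity of the map onto syzygies of (g, h, q). It is stated for degree at least 2 in u, v;
    for g and h, of degree b - 1, this is b >= 3. *)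
Lemma lift_uv c n (A B : R) : bihomog c n.+2 A -> bihomog c n.+2 B ->
  exists c0 c1 c2, [/\ bihomog c n.+1 c0, bihomog c n.+1 c1, bihomog c n.+1 c2 &
    c0 * v - c1 * u = A /\ c2 * u - c1 * v = B].
Proof.
move=> hA hB.
have xyu : (xu, xv) = (xu, xv) \/ (xu, xv) = (xv, xu) by left.
have xyv : (xv, xu) = (xu, xv) \/ (xv, xu) = (xv, xu) by right.
have [A' [al [hA' hal ->]]] := bihomog_split xyu hA.
have [B' [be [hB' hbe ->]]] := bihomog_split xyv hB.
(* The middle entry produces both pure powers u^(n+2) and v^(n+2); the corrections to the outer
   entries cancel the cross term it creates in each other equation. *)
exists (A' - be * (u * v ^+ n)), (- (al * u ^+ n.+1 + be * v ^+ n.+1)),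
  (B' - al * (v * u ^+ n)).
have hM (z w1 w2 : R) : bihomog c 0 z -> bihomog 0 1 w1 -> bihomog 0 1 w2 ->
    bihomog c n.+1 (z * (w1 * w2 ^+ n)).
  move=> hz hw1 hw2.
  apply: bihomog_eq (bihomogM hz (bihomogM hw1 (bihomogXn (n := n) hw2))) _ _;
    by rewrite ?mul0n ?addn0 ?mul1n.
have hu := bihomog_xu; have hv := bihomog_xv.
split.
- by apply: bihomogB => //; apply: hM.
- by rewrite !exprS; apply: bihomogN; apply: bihomogD; apply: hM.
- by apply: bihomogB => //; apply: hM.
by split; rewrite !exprS; ring.
Qed.

Lemma bihomog02E (f : R) : bihomog 0 2 f ->
  f = f@_(U_(xu) + U_(xu)) *: u ^+ 2 + f@_(U_(xu) + U_(xv)) *: (u * v)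
      + f@_(U_(xv) + U_(xv)) *: v ^+ 2.
Proof.
move=> hf; rewrite {1}(bihomog_biform hf) /biform.
rewrite -(pair_bigA _ (fun (i : 'I_1) (j : 'I_3) =>
     f@_(bimon 0 2 i j) *: 'X_[bimon 0 2 i j])) /=.
rewrite big_ord1 !big_ord_recr big_ord0 /= add0r.
have -> : bimon 0 2 0 0 = (U_(xv) + U_(xv))%MM.
  by apply/mnmP; apply: forall4; rewrite bimonE mnmDE !mnm1E.
have -> : bimon 0 2 0 1 = (U_(xu) + U_(xv))%MM.
  by apply/mnmP; apply: forall4; rewrite bimonE mnmDE !mnm1E.
have -> : bimon 0 2 0 2 = (U_(xu) + U_(xu))%MM.
  by apply/mnmP; apply: forall4; rewrite bimonE mnmDE !mnm1E.
by rewrite !mpolyXD !expr2 addrC [X in _ + X]addrC addrA.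
Qed.

End Lifting.

(** * Changing the basis of U and transporting syzygies *)

Section ChangeOfBasis.

(** A complement of the row space is a line, and any nonzero vector on it completes the basis. *)
Lemma row_free_complete (F : fieldType) n (A : 'M[F]_(n, n + 1)) :
  row_free A -> exists e : 'rV[F]_(n + 1), col_mx A e \in unitmx.
Proof.
move=> /eqP freeA; exists (nz_row (A^C)%MS).
set e := nz_row _.
have rC : \rank (A^C)%MS = 1%N by rewrite mxrank_compl freeA addKn.
have e0 : e != 0 by rewrite nz_row_eq0 -mxrank_eq0 rC.
have cap0 : (A :&: e = 0)%MS.
  apply/eqP; rewrite -submx0 -(capmx_compl A) capmxS //.
  exact: nz_row_sub.
rewrite -row_free_unit /row_free -addsmxE mxrank_disjoint_sum //.
by rewrite freeA rank_rV e0.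
Qed.

Variable k : fieldType.
Local Notation R := {mpoly k[4]}.
Local Notation R4 := {ffun 'I_4 -> R}.
Variables (p : 4.-tuple R) (M : 'M[k]_4).
Hypothesis unitM : M \in unitmx.

Definition new_gen (j : 'I_4) : R := \sum_i M j i *: tnth p i.

(** Coordinates travel by the transpose of [M], so that relations among the [new_gen] become
    syzygies of [p]. *)
Definition of_coords (C : 'I_4 -> R) : R4 := [ffun i => \sum_j M j i *: C j].

Lemma of_coords_syz (C : 'I_4 -> R) :
  \sum_i of_coords C i * tnth p i = \sum_j C j * new_gen j.
Proof.
under eq_bigr do rewrite ffunE mulr_suml.
rewrite exchange_big; apply: eq_bigr => j _; rewrite mulr_sumr.
by apply: eq_bigr => i _; rewrite -scalerAl -scalerAr.
Qed.

Lemma of_coords_eq0 (C : 'I_4 -> R) :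
  (forall i, of_coords C i = 0) -> forall j, C j = 0.
Proof.
move=> C0 l.
have : \sum_i (invmx M) i l *: of_coords C i = 0.
  by apply: big1 => i _; rewrite C0 scaler0.
under eq_bigr do rewrite ffunE scaler_sumr.
rewrite exchange_big /= => <-.
rewrite [LHS](_ : _ = \sum_j (M *m invmx M) j l *: C j).
  apply: eq_bigr => j _; rewrite mxE scaler_suml.
  by apply: eq_bigr => i _; rewrite scalerA mulrC.
rewrite mulmxV // (bigD1 l) //= big1 => [|j jl].
  by rewrite mxE eqxx scale1r addr0.
by rewrite mxE (negPf jl) scale0r.
Qed.

Lemma of_coords_sum (r : 'I_4 -> R) (C : 'I_4 -> 'I_4 -> R) i :
  \sum_l r l * of_coords (C l) i = of_coords (fun j => \sum_l r l * C l j) i.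
Proof.
rewrite ffunE; under eq_bigr do rewrite ffunE mulr_sumr.
rewrite exchange_big; apply: eq_bigr => j _; rewrite scaler_sumr.
by apply: eq_bigr => l _; rewrite -scalerAr.
Qed.

Lemma of_coords_bihomog c d (C : 'I_4 -> R) :
  (forall j, bihomog c d (C j)) -> forall i, bihomog c d (of_coords C i).
Proof.
by move=> hC i; rewrite ffunE; apply: bihomog_sum => j _; apply: bihomogZ.
Qed.

Lemma new_gen_meval0 (z : 'I_4 -> k) :
  (forall j, (new_gen j).@[z] = 0) -> forall i, (tnth p i).@[z] = 0.
Proof.
move=> z0 i.
pose w : 'cV[k]_4 := \col_i (tnth p i).@[z].
have Mw : M *m w = 0.
  apply/colP => j; rewrite !mxE -[RHS](z0 j) raddf_sum /=.
  by apply: eq_bigr => l _; rewrite mxE mevalZ.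
have : w = 0 by rewrite -[w](mulKmx unitM) Mw mulmx0.
by move/colP/(_ i); rewrite !mxE.
Qed.

End ChangeOfBasis.

(** * Independence of Q and the lifted Koszul syzygies *)

Section Koszul.

Variable k : closedFieldType.
Local Notation R := {mpoly k[4]}.
Local Notation u := ('X_xu : R).
Local Notation v := ('X_xv : R).

Definition row4 (T : Type) (x0 x1 x2 x3 : T) (i : 'I_4) : T :=
  nth x0 [:: x0; x1; x2; x3] i.

(** The last coordinate gives r_2 g + r_3 h = 0, so r_2 = r_3 = 0. The map to syzygies of (g, h, q)
    kills Q and sends S_1 to (h, -g, 0), so r_1 h = r_1 g = 0, whence r_1 = 0; finally r_0 u^2 =
    0. *)
Lemma koszul_free a n (g h q c10 c11 c12 c20 c21 c22 c30 c31 c32 : R)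
    (r : 'I_4 -> R) :
  bihomog a.+1 n.+2 g -> bihomog a.+1 n.+2 h -> bihomog a.+1 n.+3 q ->
  (forall s t u v, (s != 0) || (t != 0) -> (u != 0) || (v != 0) ->
     g.@[pt s t u v] = 0 -> h.@[pt s t u v] = 0 -> q.@[pt s t u v] = 0 ->
     False) ->
  c10 * v - c11 * u = h -> c12 * u - c11 * v = - g ->
  bihomog a 0 (r xu) -> bihomog a 0 (r xv) ->
  (forall j, \sum_l r l *
     row4 (row4 (u ^+ 2) (u * v) (v ^+ 2) 0) (row4 c10 c11 c12 0)
          (row4 c20 c21 c22 (- g)) (row4 c30 c31 c32 (- h)) l j = 0) ->
  forall l, r l = 0.
Proof.
move=> hg hh hq nobase eq1 eq2 hr2 hr3 rel.
have rels := rel xs; have relt := rel xt; have relu := rel xu.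
have {rel}relv := rel xv.
rewrite !sum4E /row4 /= in rels relt relu relv.
have key ga de := @syzygy_st_eq0 k a.+1 n.+3 n.+2 g h q ga de isT isT
  hg hh hq nobase.
have [r2 r3] : r xu = 0 /\ r xv = 0.
  apply: key => //; apply/eqP; rewrite -oppr_eq0 -relv; apply/eqP; ring.
rewrite r2 r3 !mul0r !addr0 in rels relt relu.
have r1h : r xt * h = 0.
  transitivity ((r xs * u ^+ 2 + r xt * c10) * v
     - (r xs * (u * v) + r xt * c11) * u); first by rewrite -eq1; ring.
  by rewrite rels relt !mul0r subrr.
have r1g : r xt * g = 0.
  apply/eqP; rewrite -oppr_eq0 -mulrN -eq2; apply/eqP.
  transitivity ((r xs * v ^+ 2 + r xt * c12) * u
     - (r xs * (u * v) + r xt * c11) * v); first by ring.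
  by rewrite relu relt !mul0r subrr.
have r1 : r xt = 0.
  have [//|rn0] := eqVneq (r xt) 0.
  have g0 : g = 0 by move/eqP: r1g; rewrite mulf_eq0 (negPf rn0) => /eqP.
  have h0 : h = 0 by move/eqP: r1h; rewrite mulf_eq0 (negPf rn0) => /eqP.
  (* If g = h = 0, the pair (t^a, 0) would be a nonzero relation, against [key]. *)
  have hX : bihomog a 0 ('X_[bimon a 0 0 0] : R) by apply: bihomog_bimon.
  have [] := key _ _ hX (@bihomog0 k a 0).
    by rewrite g0 h0 !mulr0 addr0.
  by move/eqP; rewrite -msupp_eq0 msuppX.
have r0 : r xs = 0.
  move: rels; rewrite r1 mul0r addr0 => /eqP; rewrite mulf_eq0 => /orP[/eqP//|].
  by rewrite expf_eq0 /= -msupp_eq0 msuppX.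
by apply: forall4.
Qed.

End Koszul.

(** * The basis adapted to Q, the three lifts and the count 2ab *)

Theorem theorem5p4 (k : closedFieldType) (a b : nat)
    (U : {mpoly k[4]} -> Prop) (p : 4.-tuple {mpoly k[4]})
    (Q : {ffun 'I_4 -> {mpoly k[4]}}) :
  (1 <= a)%N -> (3 <= b)%N ->
  (forall f, U f -> bihomog a b f) ->
  is_basis U p ->
  basepoint_free p ->
  syzygy_of_bidegree p 0 2 Q ->
  (forall S, ~ linear_syzygy p S) ->
  has_dim (assoc_space p Q) 3 ->
  exists S1 S2 S3 : {ffun 'I_4 -> {mpoly k[4]}},
    [/\ syzygy_of_bidegree p a (b - 2) S1,
        syzygy_of_bidegree p a (b - 1) S2,
        syzygy_of_bidegree p a (b - 1) S3,
        S2 <> S3 &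
        has_dim
          (graded_part (submod_gen [tuple Q; S1; S2; S3]) (2 * a - 1) (b - 1))
          (2 * a * b)].
Proof.
(* From here on [a.+1] and [n.+3] stand for the original a and b. *)
case: a => // a _; case: b => [|[|[|n]]] // _.
move=> hU [_ spanU] bpf [synQ Q0 hQ] _ /span_lin_indep freeV.
have hp i : bihomog a.+1 n.+3 (tnth p i).
  apply/hU/spanU; exists (fun j => (j == i)%:R).
  rewrite /lincomb (bigD1 i) //= eqxx scale1r big1 ?addr0 // => j /negPf->.
  by rewrite scale0r.
(* Row j holds the coordinates of f_j in the basis [p]; the row [e] added below defines the fourth
   form q. *)
pose A : 'M[k]_(3, 3 + 1) := \matrix_(j, i)
  nth 0 [:: (Q i)@_(U_(xu) + U_(xu)); (Q i)@_(U_(xu) + U_(xv));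
            (Q i)@_(U_(xv) + U_(xv))] j.
have /row_free_complete[e unitM] : row_free A.
  apply: inj_row_free => w wA; apply/rowP => j; rewrite mxE.
  apply: (freeV (fun j => w 0 j)); rewrite /lincomb.
  transitivity (\sum_(j < 3) \sum_i (w 0 j * A j i) *: tnth p i).
    apply: eq_bigr => j' _; under [RHS]eq_bigr do rewrite -scalerA mxE.
    rewrite -scaler_sumr; congr (_ *: _).
    by case: j' => [[|[|[|//]]] lt].
  rewrite exchange_big big1 // => i _; rewrite -scaler_suml.
  by move/rowP/(_ i): wA; rewrite !mxE => ->; rewrite scale0r.
pose M : 'M[k]_4 := col_mx A e.
rewrite -/M in unitM.
have MA (j : 'I_3) i : M (lshift 1 j) i = A j i by apply: col_mxEu.
have M0 i : M xs i = (Q i)@_(U_(xu) + U_(xu)).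
  have -> : xs = lshift 1 (Ordinal (isT : 0 < 3)%N) by apply: val_inj.
  by rewrite MA mxE.
have M1 i : M xt i = (Q i)@_(U_(xu) + U_(xv)).
  have -> : xt = lshift 1 (Ordinal (isT : 1 < 3)%N) by apply: val_inj.
  by rewrite MA mxE.
have M2 i : M xu i = (Q i)@_(U_(xv) + U_(xv)).
  have -> : xu = lshift 1 (Ordinal (isT : 2 < 3)%N) by apply: val_inj.
  by rewrite MA mxE.
pose F := new_gen p M.
have hF j : bihomog a.+1 n.+3 (F j).
  by apply: bihomog_sum => i _; apply: bihomogZ.
pose u : {mpoly k[4]} := 'X_xu; pose v : {mpoly k[4]} := 'X_xv.
pose C0 := row4 (u ^+ 2) (u * v) (v ^+ 2) 0.
have QE : Q = of_coords M C0.
  apply/ffunP => i; rewrite ffunE sum4E /C0 /row4 /= M0 M1 M2 scaler0 addr0.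
  exact: bihomog02E.
have relF : F xs * u ^+ 2 + F xt * (u * v) + F xu * v ^+ 2 = 0.
  move: synQ; rewrite /syz QE of_coords_syz sum4E /C0 /row4 /= => <-.
  rewrite -/F; ring.
have [g [h [hg hh [F0 F1 F2]]]] := syzygy_uv (hF xs) (hF xu) relF.
pose q := F xv.
have hq : bihomog a.+1 n.+3 q := hF xv.
have nobase s t y z : (s != 0) || (t != 0) -> (y != 0) || (z != 0) ->
    g.@[pt s t y z] = 0 -> h.@[pt s t y z] = 0 -> q.@[pt s t y z] = 0 -> False.
  move=> st yz g0 h0 q0.
  have [i] := bpf (pt s t y z) st yz.
  rewrite (new_gen_meval0 unitM) ?eqxx //; apply: forall4; rewrite -/F //.
  - by rewrite F0 mevalM g0 mul0r.
  - by rewrite F1 mevalN mevalD !mevalM g0 h0 !mul0r addr0 oppr0.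
  - by rewrite F2 mevalM h0 mul0r.
(* The Koszul syzygies (h, -g, 0), (q, 0, -g) and (0, q, -h) are lifted. Each lift loses one degree
   in u, v, which gives b - 2 for the first and b - 1 for the others. *)
have [c10 [c11 [c12 [h10 h11 h12 [eq10 eq11]]]]] := lift_uv hh (bihomogN hg).
have [c20 [c21 [c22 [h20 h21 h22 [eq20 eq21]]]]] :=
  lift_uv hq (@bihomog0 k a.+1 n.+3).
have [c30 [c31 [c32 [h30 h31 h32 [eq30 eq31]]]]] :=
  lift_uv (@bihomog0 k a.+1 n.+3) hq.
pose C1 := row4 c10 c11 c12 0.
pose C2 := row4 c20 c21 c22 (- g).
pose C3 := row4 c30 c31 c32 (- h).
have syn_of C : (C xs * v - C xt * u) * g + (C xu * u - C xt * v) * h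
    + C xv * q = 0 -> syz p (of_coords M C).
  move=> relC; rewrite /syz of_coords_syz sum4E -/F F0 F1 F2 -/q -/u -/v.
  by rewrite -relC; ring.
have syn1 : syz p (of_coords M C1).
  by apply: syn_of; rewrite /C1 /row4 /= eq10 eq11; ring.
have syn2 : syz p (of_coords M C2).
  by apply: syn_of; rewrite /C2 /row4 /= eq20 eq21; ring.
have syn3 : syz p (of_coords M C3).
  by apply: syn_of; rewrite /C3 /row4 /= eq30 eq31; ring.
pose S1 := of_coords M C1; pose S2 := of_coords M C2; pose S3 := of_coords M C3.
have hS1 : forall i, bihomog a.+1 n.+1 (S1 i).
  apply: of_coords_bihomog; apply: forall4 => //; exact: bihomog0.
have hS2 : forall i, bihomog a.+1 n.+2 (S2 i).
  apply: of_coords_bihomog; apply: forall4 => //; exact: bihomogN.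
have hS3 : forall i, bihomog a.+1 n.+2 (S3 i).
  apply: of_coords_bihomog; apply: forall4 => //; exact: bihomogN.
pose G := [tuple Q; S1; S2; S3].
(* The bidegrees complementary to those of Q, S_1, S_2, S_3 in (2a-1, b-1). *)
pose x := row4 (2 * a).+1 a a a; pose y := row4 n 1%N 0%N 0%N.
have freeG (r : 'I_4 -> {mpoly k[4]}) : (forall l, bihomog (x l) (y l) (r l)) ->
    (forall i, \sum_l r l * tnth G l i = 0) -> forall l, r l = 0.
  move=> hr rel; apply: (koszul_free hg hh hq nobase eq10 eq11 (hr xu) (hr xv)).
  apply: (of_coords_eq0 unitM) => i.
  rewrite -of_coords_sum -[RHS](rel i) !sum4E.
  have -> : tnth G xs = of_coords M C0 by rewrite -QE.
  by [].
(* A nonzero monomial in each complementary bidegree: multiplying by it turns a vanishing generator,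
   or an equality of S_2 and S_3, into a relation excluded by [freeG]. *)
pose mon l : {mpoly k[4]} := 'X_[bimon (x l) (y l) 0 0].
have mon0 l : mon l != 0 by rewrite -msupp_eq0 msuppX.
have hmon l : bihomog (x l) (y l) (mon l) by apply: bihomog_bimon.
have G0 l : tnth G l != 0.
  apply/eqP => Gl; case/eqP: (mon0 l).
  rewrite -(freeG (fun l' => if l' == l then mon l' else 0) _ _ l) ?eqxx //.
    by move=> l'; case: ifP => // _; apply: bihomog0.
  move=> i; apply: big1 => l' _; case: eqP => [->|_]; last by rewrite mul0r.
  by rewrite Gl ffunE mulr0.
exists S1, S2, S3.
have -> : (n.+3 - 2 = n.+1)%N by lia.
have -> : (n.+3 - 1 = n.+2)%N by lia.
have -> : (2 * a.+1 - 1 = (2 * a).+1)%N by lia.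
split.
- by split=> //; exact: (G0 xt).
- by split=> //; exact: (G0 xu).
- by split=> //; exact: (G0 xv).
- move=> S23; case/eqP: (mon0 xu).
  rewrite -(freeG (row4 0 0 (mon xu) (- mon xu)) _ _ xu) //.
    apply: forall4; rewrite /row4 /=; try exact: bihomog0; first exact: hmon.
    exact: (bihomogN (hmon xu)).
  by move=> i; rewrite sum4E /row4 /= !mul0r !add0r /tnth /= S23 mulNr subrr.
have -> : (2 * a.+1 * n.+3 = \sum_l (x l).+1 * (y l).+1)%N.
  by rewrite sum4E /x /y /row4 /=; lia.
apply: (dim_graded_part_free (e := row4 0%N a.+1 a.+1 a.+1)
  (f := row4 2 n.+1 n.+2 n.+2)).
- by apply: forall4; rewrite /x /row4 /=; lia.
- by apply: forall4; rewrite /y /row4 /=; lia.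
- by apply: forall4.
exact: freeG.
Qed.
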